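(* Let $G$ be a graph of type $\mathscr{G}_{\mathrm I}(A,B)$ with no cut vertices. Assume that either $G/(A\cup\{0\})$ is the triangle $K_3^{e,d}$ and at least one $B$-vertex is adjacent (in $G$) to more than one vertex of $A\cup\{0\}$, or $G/(A\cup\{0\})$ is equal to $K_{q+1}^{e,d}$ with $q\ge3$, where $d,e\in\mathbb{Z}^+$. Then: $G_A$ is either an $a$-star with root $0$ or equal to $K_{p+1}^{a,b}$ for some $a,b\in\mathbb{Z}^+$; every vertex of $B$ is adjacent to every vertex of $A$, all these edges having the same weight; and either $G_B$ is equal to $K_{q+1}^{c,d}$ for some $c\in\mathbb{Z}^+$, or $G[B]$ is equal to $K_q^d$ and $0$ is adjacent to no vertex of $B$.
   Context: A graph is a finite, connected, undirected, loopless multigraph with a root, viewed as a simple graph with edge-weight function $wt$ counting parallel edges. For $U\subseteq V$, $i\in U$, $d_U(i)=\sum_{j\notin U}wt(\{i,j\})$; a parking function of a rooted graph is an assignment $(b_i)$ of non-negative integers to the non-root vertices such that every non-empty set $U$ of non-root vertices contains $i$ with $b_i<d_U(i)$; $\mathcal{PF}(G)$ is their set. $G$ has type $\mathscr{G}_{\mathrm I}(A,B)$ if $V(G)=\{0\}\cup A\cup B$ with root $0$, $A=\{1,\dots,p\}$, $B=\{p+1,\dots,p+q\}$, $p,q\in\mathbb{Z}^+$; $G_A=G[\{0\}\cup A]$ is connected; and $\mathcal{PF}(G)$ is invariant under $\mathfrak{S}_p\times\mathfrak{S}_q$ acting by permuting $(b_1,\dots,b_p)$ and $(b_{p+1},\dots,b_{p+q})$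 separately. $G_B=G[\{0\}\cup B]$; $G[S]$ is an induced subgraph with inherited weights. A cut vertex is a vertex whose deletion disconnects $G$. $G/(A\cup\{0\})$ is obtained by identifying all of $A\cup\{0\}$ into one root vertex $\bar0$, keeping the vertices of $B$; distinct classes are adjacent iff some members are adjacent in $G$, with weight the sum of the weights of the $G$-edges between them. $K_{n+1}^{x,y}$ is the complete graph on the root and $n$ other vertices with weight $x$ on edges at the root and $y$ on the others (so $K_3^{e,d}$ is a triangle); $K_q^d$ is the complete graph on $q$ vertices with all weights $d$. An $a$-star with root $0$ is $K_{1,n}$ centered at $0$ with all weights $a$. *)

(* Defs.v *)
From mathcomp Require Import all_boot all_fingroup.

Set Implicit Arguments.
Unset Strict Implicit.
Unset Printing Implicit Defensive.

(* Undirected loopless multigraphs on V, as weight functions counting parallel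
   edges.  Connectedness is kept apart as the predicate [connected], because
   induced subgraphs and vertex deletions need not be connected. *)
Record mgraph (V : finType) := MGraph {
  wt : V -> V -> nat;
  wtC : forall u v, wt u v = wt v u;
  wtxx : forall u, wt u u = 0
}.

Record rooted_graph (V : finType) := RootedGraph {
  graph_of :> mgraph V;
  groot : V
}.

Definition adj (V : finType) (G : mgraph V) : rel V := fun u v => 0 < wt G u v.

Definition connected (V : finType) (G : mgraph V) : Prop :=
  forall u v : V, connect (adj G) u v.

Section Graphs.

Variable V : finType.

Section Induced.
Variables (G : mgraph V) (S : {set V}).

Definition induced_wt (u v : {x : V | x \in S}) : nat :=
  wt G (val u) (val v).

Lemma induced_wtC u v : induced_wt u v = induced_wt v u.
Proof. exact: wtC. Qed.

Lemma induced_wtxx u : induced_wt u u = 0.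
Proof. exact: wtxx. Qed.

Definition induced : mgraph {x : V | x \in S} :=
  MGraph induced_wtC induced_wtxx.

End Induced.

Definition cut_vertex (G : mgraph V) (v : V) : Prop :=
  ~ connected (induced G [set~ v]).

(* G_S = G[{groot G} :|: S] *)
Definition rinduced (G : rooted_graph V) (S : {set V}) :
    rooted_graph {x : V | x \in groot G |: S} :=
  RootedGraph (induced G (groot G |: S)) (exist _ (groot G) (setU11 (groot G) S)).

Section Contract.
Variables (G : mgraph V) (S : {set V}).

(* [None] is the class of S, [Some x] the singleton class of x outside S. *)
Definition contract_wt (u v : option {x : V | x \notin S}) : nat :=
  match u, v with
  | None, None => 0
  | None, Some y => \sum_(s in S) wt G s (val y)
  | Some x, None => \sum_(s in S) wt G s (val x)
  | Some x, Some y => wt G (val x) (val y)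
  end.

Lemma contract_wtC u v : contract_wt u v = contract_wt v u.
Proof. by case: u v => [x|] [y|] //=; exact: wtC. Qed.

Lemma contract_wtxx u : contract_wt u u = 0.
Proof. by case: u => [x|] //=; exact: wtxx. Qed.

Definition contract : rooted_graph (option {x : V | x \notin S}) :=
  RootedGraph (MGraph contract_wtC contract_wtxx) None.

End Contract.

Definition outdeg (G : mgraph V) (U : {set V}) (i : V) : nat :=
  \sum_(j | j \notin U) wt G i j.

(* Assignments to the non-root vertices are functions on all of V whose value
   at the root is irrelevant: only U avoiding the root are considered. *)
Definition parking (G : rooted_graph V) (b : V -> nat) : Prop :=
  forall U : {set V}, U != set0 -> groot G \notin U ->
    exists2 i, i \in U & b i < outdeg G U i.

End Graphs.

Definition iso (V W : finType) (G : mgraph V) (H : mgraph W) : Prop :=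
  exists f : V -> W, bijective f /\ forall u v, wt H (f u) (f v) = wt G u v.

Definition riso (V W : finType) (G : rooted_graph V) (H : rooted_graph W) : Prop :=
  exists f : V -> W,
    [/\ bijective f, f (groot G) = groot H
      & forall u v, wt H (f u) (f v) = wt G u v].

Section Complete.
Variables (n d : nat).

Definition complete_wt (i j : 'I_n) : nat := if i == j then 0 else d.

Lemma complete_wtC i j : complete_wt i j = complete_wt j i.
Proof. by rewrite /complete_wt eq_sym. Qed.

Lemma complete_wtxx i : complete_wt i i = 0.
Proof. by rewrite /complete_wt eqxx. Qed.

(* K_n^d *)
Definition complete : mgraph 'I_n := MGraph complete_wtC complete_wtxx.

End Complete.

Section RootedComplete.
Variables (n x y : nat).

Definition rcomplete_wt (i j : 'I_n.+1) : nat :=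
  if i == j then 0 else if (i == ord0) || (j == ord0) then x else y.

Lemma rcomplete_wtC i j : rcomplete_wt i j = rcomplete_wt j i.
Proof. by rewrite /rcomplete_wt eq_sym orbC. Qed.

Lemma rcomplete_wtxx i : rcomplete_wt i i = 0.
Proof. by rewrite /rcomplete_wt eqxx. Qed.

(* K_{n+1}^{x,y} *)
Definition rcomplete : rooted_graph 'I_n.+1 :=
  RootedGraph (MGraph rcomplete_wtC rcomplete_wtxx) ord0.

End RootedComplete.

(* The a-star K_{1,n} centered at the root. *)
Definition star (n a : nat) : rooted_graph 'I_n.+1 := rcomplete n a 0.

Section TypeI.
Variables (p q : nat).

Definition setA : {set 'I_(p + q).+1} := [set i : 'I_(p + q).+1 | 0 < i <= p].
Definition setB : {set 'I_(p + q).+1} := [set i : 'I_(p + q).+1 | p < i].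

Definition type_I (G : rooted_graph 'I_(p + q).+1) : Prop :=
  [/\ 0 < p /\ 0 < q,
      groot G = ord0,
      connected G,
      connected (rinduced G setA)
    & forall (s t : {perm 'I_(p + q).+1}) (b : 'I_(p + q).+1 -> nat),
        perm_on setA s -> perm_on setB t ->
        parking G b -> parking G (fun i => b ((s * t)%g i))].

End TypeI.

(* Main.v *)
Require Import Defs.
From mathcomp Require Import all_boot all_fingroup.
From mathcomp Require Import zify.

(* For sets U, W containing the root, with U connected, parking functions of
   G[W]/U extend to G: give the vertices of U the value 0, and a vertex v added
   to W the value w(W,v) - 1, so that v is burnt last.  Hence every such minor
   inherits the invariance under permutations inside A and inside B.  Burning a
   minor with two to four vertices in a chosen order, and exchanging the values
   of two vertices of the same class, relates the weights involved.

   On the B side this shows that the total weight w(U,x) from a connected U in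
   {0} + A to x in B does not depend on x: otherwise w(U,.) is d at one vertex of
   B and 0 elsewhere, which a third vertex of B excludes when q >= 3, and a second
   neighbour of a vertex of B excludes when q = 2.  Each vertex of {0} + A thus has
   one weight to all of B.  On the A side, comparing a connected S attached to B
   with S + j and S + j + k, for j, k in B, shows that the vertices of A outside S
   either all have weight 0 to B, or are all adjacent to both S and B; without cut
   vertices only the second case survives, and S can be shrunk to {0}. *)

Set Implicit Arguments.
Unset Strict Implicit.
Unset Printing Implicit Defensive.

(** * Burning on induced subgraphs, and the exchange symmetry they inherit *)

Section Parking.

Variables (V : finType) (G : rooted_graph V).
Implicit Types (S T U W : {set V}) (b : V -> nat).

Definition wset U v := \sum_(u in U) wt G u v.

Lemma wset1 u v : wset [set u] v = wt G u v.
Proof. by rewrite /wset big_set1. Qed.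

Lemma wsetU1 x U v : x \notin U -> wset (x |: U) v = wt G x v + wset U v.
Proof. by move=> xU; rewrite /wset big_setU1. Qed.

Lemma wset_sub U W v : U \subset W -> wset U v <= wset W v.
Proof.
move=> sUW; rewrite /wset [leqRHS](big_setID U) /= (setIidPr sUW).
exact: leq_addr.
Qed.

Lemma wt_le_wset x U v : x \in U -> wt G x v <= wset U v.
Proof. by move=> xU; rewrite -wset1 wset_sub // sub1set. Qed.

Lemma wset_gt0 U v : 0 < wset U v -> exists2 u, u \in U & 0 < wt G u v.
Proof.
rewrite lt0n sum_nat_eq0 negb_forall => /existsP[u].
by rewrite negb_imply -lt0n => /andP[]; exists u.
Qed.

Lemma wset_split U W v : U \subset W -> wset W v = wset U v + wset (W :\: U) v.
Proof. by move=> sUW; rewrite /wset (big_setID U) /= (setIidPr sUW). Qed.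

(* [b] is a parking function of [G[W]], with its values outside [W] ignored. *)
Definition park W b := forall T, T \subset W -> T != set0 -> groot G \notin T ->
  exists2 i, i \in T & b i < wset (W :\: T) i.

Lemma parkT b : parking G b <-> park setT b.
Proof.
have outdegE T i : outdeg G T i = wset (setT :\: T) i.
  by rewrite /outdeg /wset; apply: eq_big => [j|j _]; rewrite ?inE ?andbT // wtC.
split=> pb T; first by move=> _ T0 rT; have [i iT] := pb T T0 rT; exists i; rewrite -?outdegE.
by move=> T0 rT; have [i iT] := pb T (subsetT T) T0 rT; exists i; rewrite ?outdegE.
Qed.

Lemma eq_in_park W b b' : {in W, b =1 b'} -> park W b -> park W b'.
Proof.
move=> bb' pb T sTW T0 rT; have [i iT lti] := pb T sTW T0 rT.
by exists i; rewrite // -bb' // (subsetP sTW).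
Qed.

(** A set [T] other than [{v}] burns at the vertex where [T :\ v] burns in [W], since adding [v]
    removes nothing from the outside of [T]. The set [{v}] burns by the bound on [n]. *)
Lemma park_add W b v n : park W b -> v \notin W -> n < wset W v ->
  park (v |: W) [eta b with v |-> n].
Proof.
move=> pb vW ltn T sTW T0 rT.
have [TD0|TDn0] := eqVneq (T :\ v) set0.
  have Tv : T = [set v].
    apply/eqP; rewrite eqEsubset -setD_eq0 TD0 eqxx sub1set /=.
    by have /set0Pn[i iT] := T0; move/setP/(_ i): TD0; rewrite !inE iT andbT => /negbFE/eqP <-.
  by exists v; rewrite Tv ?set11 //= eqxx setU1K.
have [||i iT lti] := pb (T :\ v) _ TDn0; first by rewrite subDset.
  by rewrite !inE (negPf rT) andbF.
move: iT; rewrite !inE => /andP[iv iT]; exists i; rewrite //= (negPf iv).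
apply: leq_trans lti (wset_sub _ _); apply/subsetP=> z; rewrite !inE negb_and negbK.
case/andP=> H zW; rewrite zW orbT andbT; case/orP: H => // /eqP zv.
by rewrite -zv zW in vW.
Qed.

(* The value at [v] is maximal, so a set that fails to burn must either avoid [v]
   or contain no neighbour of [v]. *)
Lemma park_del W b v : groot G \in W -> v \notin W -> 0 < wset W v ->
  b v = (wset W v).-1 -> park (v |: W) b -> park W b.
Proof.
move=> rW vW w0 bv pb T sTW T0 rT.
have vT : v \notin T by apply: contra vW; apply: (subsetP sTW).
have rv : groot G != v by apply: contraNneq vW => <-.
have ED : (v |: W) :\: (v |: T) = W :\: T.
  by apply/setP=> z; rewrite !inE; case: eqVneq => // ->; rewrite (negPf vW) andbF.
have [||i] := pb (v |: T) (setUS _ sTW).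
- by apply/set0Pn; exists v; rewrite setU11.
- by rewrite !inE negb_or rv.
rewrite ED => /setU1P[->|iT]; last by exists i.
rewrite bv => ltv.
have wTv : wset T v = 0 by move: ltv w0; rewrite (wset_split v sTW); lia.
have [j jT] := pb T (subset_trans sTW (subsetU1 _ _)) T0 rT.
have E : (v |: W) :\: T = v |: (W :\: T).
  by apply/setP=> z; rewrite !inE; case: eqVneq => // ->; rewrite vT.
rewrite E wsetU1 ?inE ?negb_and ?vW ?orbT // => ltj; exists j => //.
suff: wt G v j = 0 by move: ltj; lia.
by apply/eqP; rewrite wtC -leqn0 -wTv wt_le_wset.
Qed.

(* [conn U] says that [G[U]] is connected and contains the root: burning with
   values 0 reaches everything in the connected component of the root. *)
Definition conn U := groot G \in U /\ park U (fun=> 0).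

Lemma conn_root : conn [set groot G].
Proof.
split; first exact: set11.
by move=> T; rewrite subset1 => /orP[/eqP->|/eqP->]; rewrite ?set11 ?eqxx.
Qed.

Lemma connU1 U v : conn U -> 0 < wset U v -> conn (v |: U).
Proof.
case=> rU pU wv; have [vU|vU] := boolP (v \in U); first by rewrite (setUidPr _) ?sub1set.
split; first by rewrite inE rU orbT.
by apply: eq_in_park (park_add pU vU wv) => z _ /=; case: eqP.
Qed.

(** The set [W :\: U] burns with all values 0, and the weight that burns it comes from [U]. *)
Lemma conn_cut U W : conn W -> groot G \in U -> U \subset W -> U != W ->
  exists2 v, v \in W :\: U & 0 < wset U v.
Proof.
case=> _ pW rU sUW neUW.
have [|||v] := pW (W :\: U); rewrite ?subsetDl //.
- by rewrite setD_eq0; apply: contraNN neUW => ?; rewrite eqEsubset sUW.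
- by rewrite inE rU.
by rewrite setDDr setDv set0U (setIidPr sUW); exists v.
Qed.

(* A property that holds of [U] and fails at [W] is lost at a definite vertex
   when [U] is grown to [W] one vertex at a time. *)
Lemma conn_grow (P : {set V} -> bool) U W :
    conn U -> conn W -> U \subset W -> P U -> ~~ P W ->
  exists U' v, [/\ conn U', v |: U' \subset W, v \notin U' & 0 < wset U' v] /\
    [/\ U \subset U', P U' & ~~ P (v |: U')].
Proof.
move=> cU cW; have [n] := ubnP #|W :\: U|.
elim: n U cU => // n IH U cU ltn sUW PU PW.
have [|v /setDP[vW vU] wv] := conn_cut cW (proj1 cU) sUW.
  by apply: contraNneq PW => <-.
have sW : v |: U \subset W by rewrite subUset sub1set vW.
have [PvU|] := boolP (P (v |: U)); last by exists U, v.
have [|U' [x [? [sU ? ?]]]] := IH _ (connU1 cU wv) _ sW PvU PW.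
  by move: ltn; rewrite (cardsD1 v) inE vU vW /= setDDl setUC; lia.
by exists U', x; split=> //; split=> //; apply: subset_trans sU; apply: subsetU1.
Qed.

(** A path in [G[S]] from a point of [T] to a point outside must leave [T] along some edge. Unlike
    [conn_cut], this does not ask for the root in [S], so it applies after deleting any vertex. *)
Lemma connect_cut S T : connected (induced G S) -> T \subset S ->
  T != set0 -> T != S -> exists2 i, i \in T & 0 < wset (S :\: T) i.
Proof.
move=> cS sTS /set0Pn[t tT] neTS.
have [s sS sT] : exists2 s, s \in S & s \notin T.
  apply/subsetPn; apply: contra neTS => ?; by rewrite eqEsubset sTS.
have tS := subsetP sTS t tT.
case/connectP: (cS (exist _ t tS) (exist _ s sS)) => c.
elim: c t tT tS => [|[z zS] c IH] t tT tS /=.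
  by move=> _ [Est]; rewrite Est tT in sT.
case/andP=> adj_tz pc lc; have [zT|zT] := boolP (z \in T); first exact: (IH z zT zS).
exists t => //; apply: leq_trans (wt_le_wset t (_ : z \in _)); last by rewrite !inE zT.
by rewrite wtC.
Qed.

Lemma connected_conn S : groot G \in S -> connected (induced G S) -> conn S.
Proof.
move=> rS cS; split=> // T sTS T0 rT; apply: connect_cut => //.
by apply: contraNneq rT => ->.
Qed.

Definition exch x y := forall b,
  parking G b -> parking G (fun z => b (tperm x y z)).

Lemma exchC x y : exch x y -> exch y x.
Proof. by move=> exy b; rewrite tpermC; apply: exy. Qed.

(** Induction on the complement of [W]: add a neighbour [v] of [W] with the largest value allowed by
    [park_add], exchange in the larger set, where [v] is fixed, and remove [v] again by
    [park_del]. *)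
Lemma park_exch W b x y : connected G -> exch x y -> groot G \in W ->
  x \in W -> y \in W -> park W b -> park W (fun z => b (tperm x y z)).
Proof.
move=> cG exy; have [n] := ubnP #|~: W|.
elim: n W b => // n IH W b ltn rW xW yW pb.
have [EW|neWT] := eqVneq W setT.
  by move: pb; rewrite EW => /parkT pb; apply/parkT/exy.
have cT : conn setT.
  split=> [|T _ T0 rT]; first exact: in_setT.
  have /set0Pn[t tT] := T0.
  case/connectP: (cG t (groot G)) => c; elim: c t tT => [|z c IHc] t tT /=.
    by move=> _ Er; rewrite Er tT in rT.
  case/andP=> adj_tz pc lc; have [zT|zT] := boolP (z \in T); first exact: (IHc z zT).
  exists t => //; apply: leq_trans (wt_le_wset t (_ : z \in _)); last by rewrite !inE zT.
  by rewrite wtC.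
have [v /setDP[_ vW] wv] := conn_cut cT rW (subsetT W) neWT.
have Exy z : z \in W -> tperm x y z \in W.
  by move=> zW; case: tpermP => // ->.
have vx : x != v by apply: contraNneq vW => <-.
have vy : y != v by apply: contraNneq vW => <-.
have := park_add pb vW (_ : (wset W v).-1 < wset W v); rewrite ltn_predL => /(_ wv) pv.
have {}IH := IH _ _ _ _ _ _ pv; rewrite !inE rW xW yW !orbT in IH.
have lt' : #|~: (v |: W)| < n.
  by move: ltn; rewrite (cardsD1 v (~: W)) inE vW setCU setIC -setDE /=; lia.
have {IH} pv' := park_del rW vW wv _ (IH lt' isT isT isT).
apply: eq_in_park (pv' _) => [z zW|] /=; last by rewrite tpermD ?eqxx.
by case: eqP => // E; rewrite -E (Exy z zW) in vW.
Qed.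

End Parking.

(** * Weight relations obtained by exchanging the values of two vertices *)

Section Swaps.

Variables (V : finType) (G : rooted_graph V).
Hypothesis cG : connected G.
Implicit Types (U : {set V}).

(** After [U], burn [x] and then [y], each with its largest possible value, and exchange the two
    values. The conclusions say that [{x}], [{y}] and [{x, y}] still burn. *)
Lemma swap2 U x y : conn G U -> exch G x y -> x \notin U -> y \notin U -> x != y ->
  0 < wset G U x -> 0 < wset G U y + wt G x y ->
  [/\ wset G U y <= wset G U x, wset G U x <= wset G U y + wt G x y
    & wset G U y + wt G x y <= wset G U x \/ wset G U x <= wset G U y].
Proof.
move=> [rU pU] exy xU yU xy wx wy.
have rx : groot G != x by apply: contraNneq xU => <-.
have ry : groot G != y by apply: contraNneq yU => <-.
have pred_lt m : 0 < m -> m.-1 < m by rewrite ltn_predL.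
have px := park_add pU xU (pred_lt _ wx).
have y1 : y \notin x |: U by rewrite !inE negb_or eq_sym xy.
have := park_add px y1 (pred_lt _ _); rewrite wsetU1 // addnC => /(_ wy) pxy.
have {px pxy} := park_exch cG exy _ _ _ pxy.
rewrite !inE !eqxx rU !orbT => /(_ isT isT isT) pb.
have xx : (x == y) = false by apply: negbTE.
have yx : (y == x) = false by rewrite eq_sym.
have Exy : (y |: (x |: U)) :\: [set x; y] = U.
  apply/setP=> z; rewrite !inE; case: eqVneq => [->|_]; first by rewrite (negPf xU).
  by case: eqVneq => [->|_] //=; rewrite (negPf yU).
have Ex : (y |: (x |: U)) :\: [set x] = y |: U.
  apply/setP=> z; rewrite !inE; case: eqVneq => [->|_] //=.
  by rewrite xx (negPf xU).
have Ey : (y |: (x |: U)) :\: [set y] = x |: U by rewrite setU1K.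
split.
- have [|||i /set1P ->] := pb [set x]; rewrite ?sub1set ?inE ?eqxx ?orbT //.
    by apply/set0Pn; exists x; rewrite inE.
  by rewrite Ex tpermL /= eqxx wsetU1 // (wtC G y x); lia.
- have [|||i /set1P ->] := pb [set y]; rewrite ?sub1set ?inE ?eqxx ?orbT //.
    by apply/set0Pn; exists y; rewrite inE.
  by rewrite Ey tpermR /= xx eqxx wsetU1 //; lia.
have [|||i /set2P[]->] := pb [set x; y]; rewrite ?Exy ?tpermL ?tpermR /= ?xx ?eqxx; try lia.
- by apply/subsetP=> z; rewrite !inE => /orP[]->; rewrite ?orbT.
- by apply/set0Pn; exists x; rewrite !inE eqxx.
- by rewrite !inE negb_or rx.
Qed.

Lemma wset_eq U x y : conn G U -> exch G x y -> x \notin U -> y \notin U -> x != y ->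
  0 < wset G U x -> 0 < wset G U y -> wset G U x = wset G U y.
Proof.
move=> cU exy xU yU xy wx wy.
have [] := swap2 cU exy xU yU xy wx; first by lia.
have [] := swap2 cU (exchC exy) yU xU _ wy; rewrite 1?eq_sym //; first by lia.
by lia.
Qed.

(** With [wset G U y = 0], the last alternative of [swap2] would contradict [0 < wset G U x]; the
    other bounds give both inequalities. *)
Lemma wset_eq_wt U x y : conn G U -> exch G x y -> x \notin U -> y \notin U -> x != y ->
  0 < wset G U x -> wset G U y = 0 -> 0 < wt G x y -> wset G U x = wt G x y.
Proof.
move=> cU exy xU yU xy wx wy t0.
have [] := swap2 cU exy xU yU xy wx; lia.
Qed.

(* The vertices are burnt in the order [x], [z], [y] after [U], and the values
   at [x] and [y] are exchanged; the two conclusions come from the sets [{x}]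
   and [{x, z, y}]. *)
Lemma swap3 U x z y : conn G U -> exch G x y ->
  x \notin U -> z \notin U -> y \notin U -> x != y -> z != x -> z != y ->
  0 < wset G U x -> 0 < wset G U z + wt G x z ->
  0 < wset G U y + wt G x y + wt G z y ->
  [/\ wset G U y + wt G z y <= wset G U x + wt G z x
    & [\/ wset G U y + wt G x y + wt G z y <= wset G U x, wt G x z = 0
       | wset G U x <= wset G U y]].
Proof.
move=> [rU pU] exy xU zU yU xy zx zy wx wz wy.
have rx : groot G != x by apply: contraNneq xU => <-.
have ry : groot G != y by apply: contraNneq yU => <-.
have rz : groot G != z by apply: contraNneq zU => <-.
have pred_lt m : 0 < m -> m.-1 < m by rewrite ltn_predL.
have px := park_add pU xU (pred_lt _ wx).
have z1 : z \notin x |: U by rewrite !inE negb_or zx.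
have := park_add px z1 (pred_lt _ _); rewrite wsetU1 // addnC => /(_ wz) pxz.
have y1 : y \notin z |: (x |: U) by rewrite !inE !negb_or eq_sym zy eq_sym xy.
have := park_add pxz y1 (pred_lt _ _); rewrite !wsetU1 // addnA addnC addnA [_ + wt G z y]addnC.
rewrite [wt G z y + _]addnC -addnA [wt G z y + _]addnC addnA => /(_ wy) pb0.
have {px pxz pb0} := park_exch cG exy _ _ _ pb0.
rewrite !inE !eqxx rU !orbT => /(_ isT isT isT) pb.
have xy' : (x == y) = false by apply: negbTE.
have yx' : (y == x) = false by rewrite eq_sym.
have zx' : (z == x) = false by apply: negbTE.
have zy' : (z == y) = false by apply: negbTE.
have xz' : (x == z) = false by rewrite eq_sym.
have yz' : (y == z) = false by rewrite eq_sym.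
have Exy : (y |: (z |: (x |: U))) :\: [set x; z; y] = U.
  apply/setP=> v; rewrite !inE; case: (eqVneq v x) => [->|_]; first by rewrite (negPf xU).
  case: (eqVneq v z) => [->|_] //=; first by rewrite (negPf zU).
  by case: (eqVneq v y) => [->|_] //=; rewrite (negPf yU).
have Ex : (y |: (z |: (x |: U))) :\: [set x] = y |: (z |: U).
  apply/setP=> v; rewrite !inE; case: eqVneq => [->|_] //=.
  by rewrite xy' xz' (negPf xU).
split.
- have [|||i /set1P ->] := pb [set x]; rewrite ?sub1set ?inE ?eqxx ?orbT //.
    by apply/set0Pn; exists x; rewrite inE.
  have yzU : y \notin z |: U by rewrite !inE yz'.
  by rewrite Ex tpermL /= eqxx (wsetU1 _ _ yzU) (wsetU1 _ _ zU) (wtC G y x) (wtC G z x); move: wy; clear; lia.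
have [|||i] := pb [set x; z; y]; rewrite ?Exy.
- by apply/subsetP=> v; rewrite !inE => /orP[/orP[]|]->; rewrite ?orbT.
- by apply/set0Pn; exists x; rewrite !inE eqxx.
- by rewrite !inE !negb_or rx rz.
rewrite !inE => /orP[/orP[]|] /eqP->.
- by rewrite tpermL /= eqxx => H; constructor 1; move: H wx wz wy; clear; lia.
- by rewrite tpermD 1?eq_sym ?zx' ?zy' //= zy' eqxx => H; constructor 2; move: H wx wz wy; clear; lia.
- by rewrite tpermR /= xy' xz' eqxx => H; constructor 3; move: H wx wz wy; clear; lia.
Qed.

(* As in [swap3], with the set [{x, z, t, y}]. *)
Lemma swap4 U x z t y : conn G U -> exch G x y ->
  x \notin U -> z \notin U -> t \notin U -> y \notin U ->
  uniq [:: x; z; t; y] ->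
  0 < wset G U x -> 0 < wset G U z + wt G x z ->
  0 < wset G U t + wt G x t + wt G z t ->
  0 < wset G U y + wt G x y + wt G z y + wt G t y ->
  [\/ wset G U y + wt G x y + wt G z y + wt G t y <= wset G U x, wt G x z = 0,
      wt G x t + wt G z t = 0
     | wset G U x <= wset G U y].
Proof.
move=> [rU pU] exy xU zU tU yU /= /and4P[].
rewrite !inE !negb_or => /and3P[xz xt xy] /andP[zt zy] ty _ wx wz wt wy.
have rx : groot G != x by apply: contraNneq xU => <-.
have ry : groot G != y by apply: contraNneq yU => <-.
have rz : groot G != z by apply: contraNneq zU => <-.
have rt : groot G != t by apply: contraNneq tU => <-.
have pred_lt m k : 0 < m -> k = m -> m.-1 < k by move=> ? ->; rewrite ltn_predL.
have px := park_add pU xU (pred_lt _ _ wx erefl).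
have z1 : z \notin x |: U by rewrite !inE negb_or eq_sym xz.
have := park_add px z1 (pred_lt _ _ wz _); rewrite wsetU1 // addnC => /(_ erefl) pxz.
have t1 : t \notin z |: (x |: U) by rewrite !inE !negb_or eq_sym zt eq_sym xt.
have := park_add pxz t1 (pred_lt _ _ wt _); rewrite !wsetU1 //.
have E1 k l m : k + (l + m) = m + l + k by clear; lia.
rewrite E1 => /(_ erefl) pxzt.
have y1 : y \notin t |: (z |: (x |: U)) by rewrite !inE !negb_or !(eq_sym y) ty zy xy.
have := park_add pxzt y1 (pred_lt _ _ wy _); rewrite !wsetU1 //.
have E2 k l m n : k + (l + (m + n)) = n + m + l + k by clear; lia.
rewrite E2 => /(_ erefl) pb0.
have {px pxz pxzt pb0} := park_exch cG exy _ _ _ pb0.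
rewrite !inE !eqxx rU !orbT => /(_ isT isT isT) pb.
have Exy : (y |: (t |: (z |: (x |: U)))) :\: [set x; z; t; y] = U.
  apply/setP=> v; rewrite !inE; case: (eqVneq v x) => [->|_]; first by rewrite (negPf xU).
  case: (eqVneq v z) => [->|_] //=; first by rewrite (negPf zU).
  case: (eqVneq v t) => [->|_] //=; first by rewrite (negPf tU).
  by case: (eqVneq v y) => [->|_] //=; rewrite (negPf yU).
have [|||i] := pb [set x; z; t; y]; rewrite ?Exy.
- by apply/subsetP=> v; rewrite !inE => /orP[/orP[/orP[]|]|]->; rewrite ?orbT.
- by apply/set0Pn; exists x; rewrite !inE eqxx.
- by rewrite !inE !negb_or rx rz rt.
rewrite !inE => /orP[/orP[/orP[]|]|] /eqP->.
- by rewrite tpermL /= eqxx => H; constructor 1; move: H wx wz wt wy; clear; lia.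
- rewrite tpermD ?(eq_sym y) //= (negPf zy) (negPf zt) eqxx => H; constructor 2; move: H wx wz wt wy; clear; lia.
- rewrite tpermD ?(eq_sym y) //= (negPf ty) eqxx => H; constructor 3; move: H wx wz wt wy; clear; lia.
- by rewrite tpermR /= (negPf xy) (negPf xt) (negPf xz) eqxx => H; constructor 4; move: H wx wz wt wy; clear; lia.
Qed.

End Swaps.

(** * The B side: a connected part of {0} + A has the same weight to every vertex of B *)

Section TwoClasses.

Variables (V : finType) (G : rooted_graph V) (A B : {set V}) (d e : nat).
Implicit Types (D S T U W : {set V}).

Local Notation r := (groot G).
Local Notation w := (wset G).
Local Notation A0 := (groot G |: A).

Hypotheses (cG : connected G) (rB : r \notin B) (AB : [disjoint A & B]).
Hypothesis exA : {in A &, forall x y, exch G x y}.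
Hypothesis exB : {in B &, forall x y, exch G x y}.
Hypothesis cA : conn G A0.
Hypotheses (d_gt0 : 0 < d) (e_gt0 : 0 < e).
Hypothesis wtB : {in B &, forall x y, x != y -> wt G x y = d}.
Hypothesis wA0B : {in B, forall x, w A0 x = e}.

Lemma A0_notB x : x \in A0 -> x \notin B.
Proof. by case/setU1P=> [->//|xA]; rewrite (disjointFr AB). Qed.

Lemma subA0_notB U x : U \subset A0 -> x \in B -> x \notin U.
Proof. by move=> sU; apply: contraTN => /(subsetP sU)/A0_notB. Qed.

Lemma neq_AB x y : x \in A0 -> y \in B -> x != y.
Proof. by move=> /A0_notB xB yB; apply: contraNneq xB => ->. Qed.

Lemma B_dichotomy U x y : conn G U -> U \subset A0 -> x \in B -> y \in B ->
  0 < w U x -> w U y = w U x \/ w U y = 0 /\ w U x = d.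
Proof.
move=> cU sU xB yB wx; have [->|neq] := eqVneq x y; first by left.
have [xU yU] := (subA0_notB sU xB, subA0_notB sU yB).
case: (posnP (w U y)) => [w0|wy]; [right|left].
  by split=> //; rewrite -(wtB xB yB neq) (wset_eq_wt cG cU (exB xB yB)) // wtB.
by rewrite (wset_eq cG cU (exB xB yB)).
Qed.

Definition uniform := forall U x y, conn G U -> U \subset A0 -> x \in B -> y \in B ->
  w U x = w U y.

(** By [B_dichotomy], uniformity can only fail with weight [d] at one vertex of [B] and 0 at
    another. *)
Lemma uniform_wlog :
  (forall U x y, conn G U -> U \subset A0 -> x \in B -> y \in B -> x != y ->
     w U x = d -> w U y = 0 -> False) -> uniform.
Proof.
move=> H U x y cU sU xB yB; have [->//|neq] := eqVneq x y.
case: (posnP (w U x)) => [x0|wx].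
  case: (posnP (w U y)) => [-> //|wy].
  have [//|[_ yd]] := B_dichotomy cU sU yB xB wy.
  by case: (H U y x); rewrite // eq_sym.
have [//|[y0 xd]] := B_dichotomy cU sU xB yB wx.
by case: (H U x y).
Qed.

(** A third vertex [z] of [B] has weight [d] or 0 from [U]. If [d], then [z |: U] has the unequal
    positive weights 2d and d to [x] and [y]. If 0, burning [x], [y], [z] and exchanging [x] with
    [z] contradicts [swap3]. *)
Lemma uniform_gt2 : 2 < #|B| -> uniform.
Proof.
move=> B3; apply: uniform_wlog => U x y cU sU xB yB neq wx wy.
have /card_gt0P[z] : 0 < #|B :\ x :\ y|.
  by move: B3; rewrite (cardsD1 x) xB (cardsD1 y) !inE yB eq_sym neq.
rewrite !inE => /and3P[zy zx zB].
have xU := subA0_notB sU xB; have yU := subA0_notB sU yB; have zU := subA0_notB sU zB.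
have wx0 : 0 < w U x by rewrite wx.
have wtxy := wtB xB yB neq; have wtzy := wtB zB yB zy; have wtzx := wtB zB xB zx.
have [Ez|[wz _]] := B_dichotomy cU sU xB zB wx0.
  have cUz : conn G (z |: U) by apply: connU1; rewrite // Ez.
  have := wset_eq cG cUz (exB xB yB) _ _ neq.
  rewrite !inE !negb_or !(eq_sym _ z) zx zy xU yU !wsetU1 // wtzx wtzy wx wy.
  by move=> /(_ isT isT); move: d_gt0; clear; lia.
have [|||||_] := swap3 cG cU (exB xB zB) xU yU zU _ _ _ wx0; rewrite 1?eq_sym //.
- by rewrite wtxy wy.
- by rewrite (wtC _ y z) wtzy addn_gt0 d_gt0 orbT.
by rewrite wtxy (wtC _ y z) wtzy (wtC _ x z) wtzx wx wz; case; move: d_gt0; clear; lia.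
Qed.

Lemma conn_max U D : conn G U -> U \subset D -> exists W,
  [/\ conn G W, U \subset W, W \subset D & forall y, y \in D :\: W -> w W y = 0].
Proof.
have [n] := ubnP #|D :\: U|; elim: n U => // n IH U ltn cU sUD.
have [/exists_inP[y /setDP[yD yU] wy]|] := boolP [exists (y | y \in D :\: U), 0 < w U y].
  have [|||W [cW sW sD W0]] := IH (y |: U).
  - by move: ltn; rewrite (cardsD1 y) inE yU yD /= setDDl setUC.
  - exact: connU1.
  - by rewrite subUset sub1set yD.
  by exists W; split=> //; apply: subset_trans sW; apply: subsetU1.
rewrite negb_exists_in => /forall_inP H; exists U; split=> // y yDU.
by apply/eqP; rewrite -leqn0 leqNgt; apply: H.
Qed.

(** Since [y] has weight 0, every connected part of [U] has weight 0 or [d] to [x]. So, as [U] is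
    grown from the root, the whole of [d] arrives with a single vertex [s], which is then the only
    neighbour of [x] in [U]. *)
Lemma unique_nbr U x y : conn G U -> U \subset A0 -> x \in B -> y \in B -> x != y ->
  w U x = d -> w U y = 0 -> exists2 s, s \in U & wt G s x = d.
Proof.
move=> cU sU xB yB neq wx wy; have [rU _] := cU.
have wd W : conn G W -> W \subset U -> 0 < w W x -> w W x = d.
  move=> cW sW wW; have := wset_sub G y sW; rewrite wy leqn0 => /eqP y0.
  have [Exy|[]//] := B_dichotomy cW (subset_trans sW sU) xB yB wW.
  by move: wW; rewrite -Exy y0.
case: (posnP (w [set r] x)) => [r0|wr]; last first.
  by exists r => //; rewrite -wset1; apply: wd wr => //; [exact: conn_root|rewrite sub1set].
have [||W [s [[cW sWU sW ws] [_ /eqP W0 Ws]]]] :=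
  conn_grow (P := fun W => w W x == 0) (conn_root G) cU _ (introT eqP r0).
- by rewrite sub1set.
- by rewrite wx -lt0n.
exists s; first by rewrite (subsetP sWU) // setU11.
rewrite -[RHS](wd (s |: W)) ?lt0n //; last exact: connU1.
by rewrite wsetU1 // W0 addn0.
Qed.

(* Growing U, the first vertex a joined to y satisfies w(a,y) = d and w(a,x) = 0.
   Let U0 be the component of the root in G_A - a.  If U0 + a is all of {0} + A,
   then x and y have one neighbour each.  Otherwise some z outside is adjacent to a
   but not to U0, and a, z, x, y over U0 contradict the invariance. *)
Lemma uniform_eq2 v : #|B| = 2 -> v \in B ->
  1 < #|[set u in A0 | adj G v u]| -> uniform.
Proof.
move=> B2 vB v2; apply: uniform_wlog => U x y cU sU xB yB neq wx wy.
have Bxy z : z \in B -> z = x \/ z = y.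
  have : #|B :\ x :\ y| == 0.
    by move: B2; rewrite (cardsD1 x) xB (cardsD1 y) !inE yB eq_sym neq; clear; lia.
  rewrite cards_eq0 => /eqP/setP/(_ z); rewrite !inE => H zB; move: H; rewrite zB andbT.
  by case: eqP => [|_]; [right|case: eqP => //; left].
have wtxy := wtB xB yB neq.
have wtyx : wt G y x = d by rewrite wtC.
have exy := exB xB yB.
have [|U1 [a [[cU1 sU1 aU1 wa] [sUU1 /eqP wy1 wya]]]] :=
  conn_grow (P := fun W => w W y == 0) cU cA sU (introT eqP wy).
  by rewrite wA0B // -lt0n.
have /andP[aA0 sU1A] : (a \in A0) && (U1 \subset A0) by rewrite -sub1set -subUset.
have wx1 : w U1 x = d.
  have wx1 : 0 < w U1 x by apply: leq_trans (wset_sub G x sUU1); rewrite wx.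
  by have [E|[]//] := B_dichotomy cU1 sU1A xB yB wx1; rewrite -E wy1 in wx1.
have wtay0 : 0 < wt G a y by move: wya; rewrite wsetU1 // wy1 addn0 lt0n.
have [xa ya] : x != a /\ y != a by rewrite !(eq_sym _ a) !neq_AB.
(* Burning [x], [a], [y] after [U1] and exchanging [x] with [y] is impossible if [a] and [x] are
   adjacent. *)
have wtax : wt G a x = 0.
  have [|||||_] := swap3 cG cU1 exy (subA0_notB sU1A xB) aU1 (subA0_notB sU1A yB) neq.
  - by rewrite eq_sym.
  - by rewrite eq_sym.
  - by rewrite wx1.
  - by rewrite addn_gt0 wa.
  - by rewrite wtxy addn_gt0 addn_gt0 d_gt0 orbT.
  by rewrite wx1 wy1 wtxy (wtC _ a x); case; move: wtay0 d_gt0; clear; lia.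
have wtay : wt G a y = d.
  have [|E|[]] := B_dichotomy (connU1 cU1 wa) sU1 xB yB.
  - by rewrite wsetU1 // wx1 wtax.
  - by move: E; rewrite !wsetU1 // wx1 wtax wy1 addn0.
  - by rewrite wsetU1 // wy1; move: wtay0; clear; lia.
have raA0 : a != r by apply: contraNneq aU1 => ->; case: cU1.
have aA : a \in A by case/setU1P: aA0 => // E; rewrite E eqxx in raA0.
have [|U0 [cU0 sU10 sU0 U0max]] := @conn_max U1 (A0 :\ a) cU1; first by rewrite subsetD1 sU1A.
move: sU0; rewrite subsetD1 => /andP[sU0 aU0].
have wa0 : 0 < w U0 a by apply: leq_trans wa (wset_sub G a sU10).
have sU0a : a |: U0 \subset A0 by rewrite subUset sub1set aA0.
have cU0a := connU1 cU0 wa0.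
(* If [x] and [y] had the same positive weight from [U0], adding [a] would raise only that of [y],
   leaving two unequal positive weights. *)
have [wx0 wy0] : w U0 x = d /\ w U0 y = 0.
  have wx0 : 0 < w U0 x by apply: leq_trans (wset_sub G x sU10); rewrite wx1.
  have [E|[] //] := B_dichotomy cU0 sU0 xB yB wx0.
  have [||[]] := B_dichotomy cU0a sU0a xB yB; rewrite !wsetU1 // ?wtax ?wtay ?E;
    by move: d_gt0 wx0; clear; lia.
have [EA0|neA0] := eqVneq (a |: U0) A0.
  move: v2; suff [s Hs] : exists s, [set u in A0 | adj G v u] \subset [set s].
    by apply/negP; rewrite -leqNgt -(cards1 s) subset_leq_card.
  have [->|->] := Bxy v vB; last first.
    exists a; apply/subsetP=> u; rewrite inE -EA0 => /andP[/setU1P[->|uU0]]; first by rewrite inE.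
    rewrite /adj wtC => ltu; have := leq_trans ltu (wt_le_wset G y uU0).
    by rewrite wy0.
  have [s sU0' wts] := unique_nbr cU0 sU0 xB yB neq wx0 wy0.
  exists s; apply/subsetP=> u; rewrite inE -EA0 => /andP[/setU1P[->|uU0]].
    by rewrite /adj wtC wtax.
  rewrite /adj wtC inE; case: eqVneq => // us ltu.
  have : w (u |: [set s]) x <= w U0 x by apply: wset_sub; rewrite subUset !sub1set uU0.
  by rewrite wsetU1 ?inE // wset1 wts wx0; move: ltu; clear; lia.
have [|z /setDP[zA0 zU0a] wz] := conn_cut cA _ sU0a neA0.
  by rewrite inE (proj1 cU0) orbT.
move: (zU0a); rewrite !inE negb_or => /andP[za zU0].
have wz0 : w U0 z = 0 by apply: U0max; rewrite !inE zU0 za; case/setU1P: zA0 => ->; rewrite ?eqxx ?orbT.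
move: (wz); rewrite wsetU1 // wz0 addn0 => wtaz.
have zA : z \in A by case/setU1P: zA0 => // E; rewrite E (proj1 cU0) in zU0.
have [zx zy] : x != z /\ y != z by rewrite !(eq_sym _ z) !neq_AB.
have wtz : wt G z x = wt G z y.
  have sz : z |: (a |: U0) \subset A0 by rewrite subUset sub1set zA0.
  have [||[]] := B_dichotomy (connU1 cU0a wz) sz xB yB;
    rewrite !wsetU1 // ?wtax ?wtay ?wx0 ?wy0; move: d_gt0; clear; lia.
have xU0 := subA0_notB sU0 xB; have yU0 := subA0_notB sU0 yB.
have az : a != z by rewrite eq_sym.
(* If [z] is adjacent to neither [x] nor [y], exchange [a] with [z]: the weight of [a] from
   [x |: U0] and from [y |: (x |: U0)] must both equal [wt G a z], yet they differ by [d]. *)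
have [z0|zx0] := posnP (wt G z x).
  have cx : conn G (x |: U0) by apply: connU1; rewrite // wx0.
  have cyx : conn G (y |: (x |: U0)) by apply: connU1; rewrite // wsetU1 // wtxy wy0 addn0.
  have xa' : a != x by rewrite eq_sym.
  have ya' : a != y by rewrite eq_sym.
  have zx' : z != x by rewrite eq_sym.
  have zy' : z != y by rewrite eq_sym.
  have ax : a \notin x |: U0 by rewrite !inE negb_or xa'.
  have zxU : z \notin x |: U0 by rewrite !inE negb_or zx'.
  have yxU : y \notin x |: U0 by rewrite !inE negb_or eq_sym neq.
  have ayx : a \notin y |: (x |: U0) by rewrite in_setU1 negb_or ya'.
  have zyx : z \notin y |: (x |: U0) by rewrite in_setU1 negb_or zy'.
  have := wset_eq_wt cG cx (exA aA zA) ax zxU az.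
  have := wset_eq_wt cG cyx (exA aA zA) ayx zyx az.
  rewrite !wsetU1 // !(wtC _ x) !(wtC _ y) wtax wtay -wtz z0 wz0.
  by move: wa0 d_gt0 wtaz; clear; lia.
(* If [z] is adjacent to both, burn [x], [z], [a], [y] after [U0]; all four alternatives of [swap4]
   fail. *)
have [||||||||] := swap4 cG cU0 exy xU0 zU0 aU0 yU0 _; rewrite ?wx0 ?wy0 ?wz0 ?wtxy ?(wtC _ x z) ?(wtC _ z a) //=.
- by rewrite !inE !negb_or zx xa neq za (eq_sym z) zy (eq_sym a) ya.
- by rewrite !addn_gt0 wa0.
- by rewrite !addn_gt0 d_gt0 !orbT.
- by move: zx0; rewrite wtz; clear; lia.
- by move: zx0; clear; lia.
- by move: wtaz; clear; lia.
by move: d_gt0; clear; lia.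
Qed.


(** * The A side: every vertex of A is adjacent to the root and to all of B *)

Hypothesis rA : r \notin A.
Hypothesis coverAB : forall v, v \in A0 \/ v \in B.
Hypothesis nocut : forall v, connected (induced G [set~ v]).
Hypothesis A_neq0 : A != set0.
Hypothesis unif : uniform.
Variables j k : V.
Hypotheses (jB : j \in B) (kB : k \in B) (jk : j != k).

Lemma A0A x U : conn G U -> x \in A0 -> x \notin U -> x \in A.
Proof. by case=> rU _ /setU1P[->|//]; rewrite rU. Qed.

(** For [x] other than the root, grow from the root until [x] is added to some connected [U]; the
    weight at [x] is the difference of the uniform weights from [x |: U] and from [U]. *)
Lemma wtAB x : x \in A0 -> {in B &, forall y z, wt G x y = wt G x z}.
Proof.
move=> xA0 y z yB zB; have [->|xr] := eqVneq x r.
  by rewrite -!wset1; apply: unif; rewrite ?sub1set ?setU11 //; apply: conn_root.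
have [|||U [s [[cU sU sN ws] [_ xU]]]] :=
  conn_grow (P := fun U => x \notin U) (conn_root G) cA.
- by rewrite sub1set setU11.
- by rewrite inE.
- by rewrite xA0.
rewrite in_setU1 (negPf xU) orbF negbK => /eqP Ex; move: sN ws sU; rewrite -Ex => sN ws sU.
have sUA : U \subset A0 by apply: subset_trans sU; apply: subsetU1.
have := unif (connU1 cU ws) sU yB zB; rewrite !wsetU1 // (unif cU sUA yB zB).
exact: addIn.
Qed.

Lemma wt_eq_attached S x y : conn G S -> S \subset A0 -> 0 < w S j ->
  x \in A -> y \in A -> x \notin S -> y \notin S -> 0 < w S x -> 0 < w S y ->
  wt G x j = wt G y j.
Proof.
move=> cS sS wj xA yA xS yS wx wy; have [->//|neq] := eqVneq x y.
have [xA0 yA0] : x \in A0 /\ y \in A0 by rewrite !inE xA yA !orbT.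
have jS := subA0_notB sS jB.
have xjS : x \notin j |: S by rewrite in_setU1 negb_or xS neq_AB.
have yjS : y \notin j |: S by rewrite in_setU1 negb_or yS neq_AB.
have := wset_eq cG (connU1 cS wj) (exA xA yA) xjS yjS neq.
rewrite !wsetU1 // (wset_eq cG cS (exA xA yA)) // !addn_gt0 wy !orbT => /(_ isT isT).
by rewrite !(wtC _ j); apply: addIn.
Qed.

(** If [wt G y j] were positive, equating the weights of [x] and [y] over [j |: S] and over
    [k |: (j |: S)] would force [w S x = 0]. If [x] and [y] are adjacent, [wt G x y] equals the
    weight of [x] from [S] and also from [j |: S], so [j] contributes nothing. *)
Lemma wt0_attached S x y : conn G S -> S \subset A0 -> 0 < w S j ->
  x \in A -> y \in A -> x \notin S -> y \notin S -> 0 < w S x -> w S y = 0 ->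
  wt G y j = 0 /\ (0 < wt G x y -> wt G x j = 0).
Proof.
move=> cS sS wj xA yA xS yS wx wy.
have neq : x != y by apply: contraTneq wx => ->; rewrite wy.
have [xA0 yA0] : x \in A0 /\ y \in A0 by rewrite !inE xA yA !orbT.
have jS := subA0_notB sS jB; have kS := subA0_notB sS kB.
have xjS : x \notin j |: S by rewrite in_setU1 negb_or xS neq_AB.
have yjS : y \notin j |: S by rewrite in_setU1 negb_or yS neq_AB.
have kjS : k \notin j |: S by rewrite in_setU1 negb_or kS eq_sym jk.
have xkjS : x \notin k |: (j |: S) by rewrite in_setU1 negb_or xjS neq_AB.
have ykjS : y \notin k |: (j |: S) by rewrite in_setU1 negb_or yjS neq_AB.
have cj := connU1 cS wj.
have ck : conn G (k |: (j |: S)).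
  by apply: connU1 => //; rewrite wsetU1 // (wtB jB kB jk) addn_gt0 d_gt0.
have wtk z : z \in A0 -> wt G k z = wt G j z by move=> zA0; rewrite !(wtC _ _ z) (wtAB zA0 kB jB).
have y0 : wt G y j = 0.
  have := wset_eq cG cj (exA xA yA) xjS yjS neq.
  have := wset_eq cG ck (exA xA yA) xkjS ykjS neq.
  rewrite !wsetU1 // !wtk // wy (wtC _ j y).
  by move: wx; clear; case: (wt G y j) => [|n] //; lia.
split=> // xy; have := wset_eq_wt cG cS (exA xA yA) xS yS neq wx wy xy.
have := wset_eq_wt cG cj (exA xA yA) xjS yjS neq.
rewrite !wsetU1 // wy !(wtC _ j) y0.
by move: wx xy; clear; lia.
Qed.

Lemma attached_dichotomy S : conn G S -> S \subset A0 -> 0 < w S j ->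
  {in A :\: S, forall y, wt G y j = 0} \/
  {in A :\: S, forall y, 0 < w S y /\ 0 < wt G y j}.
Proof.
move=> cS sS wj; have rS := proj1 cS.
have [ES|neS] := eqVneq S A0.
  by left=> y /setDP[yA]; rewrite ES !inE yA orbT.
have [x /setDP[xA0 xS] wx] := conn_cut cA rS sS neS.
have xA := A0A cS xA0 xS.
case: (posnP (wt G x j)) => [x0|xj]; [left|right] => y /setDP[yA yS].
  case: (posnP (w S y)) => [wy|wy].
    by have [] := wt0_attached cS sS wj xA yA xS yS wx wy.
  by rewrite -(wt_eq_attached cS sS wj xA yA xS yS).
suff wy : 0 < w S y by rewrite -(wt_eq_attached cS sS wj xA yA xS yS).
rewrite lt0n; apply/negP => wy.
(* If some vertex has no neighbour in [S], connectedness of [G_A] gives an edge from a vertex [u]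
   attached to [S] to such a vertex. Then [wt0_attached] makes [wt G u j] zero, although it equals
   [wt G x j]. *)
pose T := [set v in A0 :\: S | w S v == 0].
have [|||v] := conn_cut (U := A0 :\: T) cA; rewrite ?subsetDl //.
- by rewrite !inE rS eqxx.
- apply/negP => /eqP/setP/(_ y); rewrite !inE yA (negPf yS) wy /= !orbT.
  by [].
rewrite setDDr setDv set0U => /setIP[_]; rewrite inE => /andP[/setDP[vA0 vS] /eqP v0].
case/wset_gt0=> u /setDP[uA0 uT] wtuv.
have uS : u \notin S.
  by apply/negP => uS; have := leq_trans wtuv (wt_le_wset G v uS); rewrite v0.
have wu : 0 < w S u by move: uT; rewrite inE in_setD uS uA0 lt0n.
have uA := A0A cS uA0 uS; have vA := A0A cS vA0 vS.
have [_ /(_ wtuv)] := wt0_attached cS sS wj uA vA uS vS wu v0.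
rewrite (wt_eq_attached cS sS wj uA xA uS xS wu wx) => E.
by rewrite E in xj.
Qed.

(** Otherwise deleting the root would separate [A] from [B]. *)
Lemma A_attached : exists2 x, x \in A & 0 < wt G x j.
Proof.
have [||x xA] := connect_cut (@nocut r) _ A_neq0.
- by apply/subsetP=> x xA; rewrite !inE; apply: contraNneq rA => <-.
- apply/negP => /eqP/setP/(_ j); rewrite !inE (disjointFl AB jB) => /esym/negbFE/eqP E.
  by have := rB; rewrite -E jB.
case/wset_gt0=> u; rewrite !inE => /andP[uA ur] wtux; exists x => //.
have [uA0|uB] := coverAB u; first by case/setU1P: uA0 => E; [rewrite E eqxx in ur|move: uA; rewrite E].
by rewrite (wtAB _ jB uB) ?inE ?xA ?orbT // wtC.
Qed.

(* Otherwise p would be a cut vertex separating B from the root. *)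
Lemma wt_gt0_outside U p : conn G U -> U \subset A0 -> w U j = 0 ->
  p \in A -> p \notin U -> 0 < w U p -> 0 < wt G p j ->
  {in A :\: U, forall y, 0 < wt G y j}.
Proof.
move=> cU sU wj pA pU wp pj.
have sS : p |: U \subset A0 by rewrite subUset sub1set inE pA orbT.
have [|H0|H y /setDP[yA yU]] := attached_dichotomy (connU1 cU wp) sS.
- by rewrite wsetU1 // addn_gt0 pj.
- have pj' : j != p by rewrite eq_sym neq_AB // inE pA orbT.
  have [|||i iB] := connect_cut (@nocut p) (T := B).
  + apply/subsetP=> x xB; rewrite !inE eq_sym neq_AB // inE pA orbT //.
  + by apply/set0Pn; exists j.
  + apply/negP => /eqP/setP/(_ r); rewrite !inE (negPf rB) => /esym/negbFE/eqP E.
    by move: pU; rewrite -E (proj1 cU).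
  case/wset_gt0=> u; rewrite !inE => /andP[uB up]; have [uA0|] := coverAB u; last by rewrite (negPf uB).
  rewrite (wtAB uA0 iB jB); have [uU|uU] := boolP (u \in U).
    by move=> lt0; have := leq_trans lt0 (wt_le_wset G j uU); rewrite wj.
  by rewrite H0 // !inE negb_or up uU (A0A cU).
have [->//|yp] := eqVneq y p.
by have [] := H y; rewrite // !inE negb_or yp yU.
Qed.

(* Grow U from the root until it meets the set P of vertices of A joined to B: the
   last vertex z added before P is reached would be a cut vertex. *)
Lemma wt_gt0_unattached : wt G r j = 0 -> {in A, forall y, 0 < wt G y j}.
Proof.
move=> c0; have [p0 p0A p0j] := A_attached.
(* [P U] says that no vertex of [A] joined to [B] has a neighbour in [U]. *)
pose P U := [forall p in A, (0 < wt G p j) ==> (w U p == 0)].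
have PP U : ~~ P U -> exists p, [/\ p \in A, 0 < wt G p j & 0 < w U p].
  rewrite negb_forall_in => /exists_inP[p pA].
  by rewrite negb_imply -lt0n => /andP[]; exists p.
have sr : [set r] \subset A0 by rewrite sub1set setU11.
have [Pr|nPr] := boolP (P [set r]); last first.
  have [p [pA pj wp]] := PP _ nPr; move=> y yA.
  have nr z : z \in A -> z \notin [set r] by rewrite inE; apply: contraTneq => ->.
  apply: (wt_gt0_outside (conn_root G) sr _ pA (nr _ pA) wp pj); rewrite ?wset1 //.
  by rewrite inE nr.
have PA : ~~ P A0.
  apply/negP => /forall_inP/(_ _ p0A); rewrite p0j /= => /eqP E.
  have [|||i /set1P->] := (proj2 cA) [set p0].
  - by rewrite sub1set inE p0A orbT.
  - by apply/set0Pn; exists p0; rewrite inE.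
  - by rewrite inE; apply: contraNneq rA => ->.
  by rewrite ltnNge -E => /negP[]; apply: wset_sub; apply: subsetDl.
have [U [z [[cU sU zU wz] [_ PU nPz]]]] := conn_grow (conn_root G) cA sr Pr PA.
have PU' p : p \in A -> 0 < wt G p j -> w U p = 0.
  by move=> pA pj; have /forall_inP/(_ p pA) := PU; rewrite pj => /eqP.
have [zA0 sUA] : z \in A0 /\ U \subset A0.
  by apply/andP; rewrite -sub1set -subUset.
have zA := A0A cU zA0 zU.
have z0 : wt G z j = 0.
  by case: (posnP (wt G z j)) => // zj; rewrite (PU' z) in wz.
(* A vertex of [U] joined to [j] would have a neighbour in [U], because [U] is connected, against
   [PU]. *)
have Uj u : u \in U -> wt G u j = 0.
  move=> uU; have /setU1P[->//|uA] := subsetP sUA u uU.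
  case: (posnP (wt G u j)) => // uj.
  have [|||i /set1P->] := (proj2 cU) [set u]; rewrite ?sub1set //.
  - by apply/set0Pn; exists u; rewrite inE.
  - by rewrite inE; apply: contraNneq rA => ->.
  by rewrite ltnNge -(PU' u uA uj) => /negP[]; apply: wset_sub; apply: subsetDl.
have wUj : w U j = 0.
  by case: (posnP (w U j)) => // /wset_gt0[u uU]; rewrite Uj.
have [p [pA pj wp]] := PP _ nPz.
have pzU : p \notin z |: U.
  rewrite !inE negb_or; apply/andP; split; first by apply: contraTneq pj => ->; rewrite z0.
  by apply: contraTN pj => /Uj ->.
have wzUj : w (z |: U) j = 0 by rewrite wsetU1 // z0 wUj.
have pos := wt_gt0_outside (connU1 cU wz) sU wzUj pA pzU wp pj.
(* Without [z], some edge must leave [U]. Its other end is not in [A], since there it would be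
   joined to [j] and so have no neighbour in [U], nor in [B], since [U] has weight 0 to [B]. *)
have [|||i iU] := connect_cut (@nocut z) (T := U).
- by apply/subsetP=> x xU; rewrite !inE; apply: contraNneq zU => <-.
- by apply/set0Pn; exists r; apply: (proj1 cU).
- apply/negP => /eqP/setP/(_ j); rewrite !inE (negPf (subA0_notB sUA jB)) => /esym/negbFE.
  by rewrite eq_sym; apply/negP/neq_AB.
case/wset_gt0=> u; rewrite !inE => /andP[uU uz].
have [uA0|uB] := coverAB u => wtui.
  have uA := A0A cU uA0 uU.
  have := leq_trans (_ : 0 < wt G i u) (wt_le_wset G u iU); rewrite wtC PU' ?(pos u) //.
    by move/(_ wtui).
  by rewrite !inE negb_or uz uU.
have iA0 := subsetP sUA i iU.
by move: wtui; rewrite wtC (wtAB iA0 uB jB) Uj.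
Qed.

Lemma root_adj : {in A, forall y, 0 < wt G r y /\ 0 < wt G y j}.
Proof.
have cr := conn_root G.
have sr : [set r] \subset A0 by rewrite sub1set setU11.
have nr z : z \in A -> z \notin [set r] by rewrite inE; apply: contraTneq => ->.
case: (posnP (wt G r j)) => [c0|c_gt0].
  have pos := wt_gt0_unattached c0; move=> y yA; split; last exact: pos.
  rewrite lt0n; apply/negP => y0; pose T := [set v in A | wt G r v == 0].
  have [|||v] := conn_cut (U := A0 :\: T) cA; rewrite ?subsetDl //.
  - by rewrite !inE eqxx (negPf rA).
  - by apply/negP => /eqP/setP/(_ y); rewrite !inE yA y0 /= !orbT.
  rewrite setDDr setDv set0U => /setIP[_]; rewrite inE => /andP[vA /eqP v0].
  case/wset_gt0=> u /setDP[uA0 uT] wtuv.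
  have ur : u != r by apply: contraTneq wtuv => ->; rewrite v0.
  have uA : u \in A by case/setU1P: uA0 => // E; rewrite E eqxx in ur.
  have wtru : 0 < wt G r u by move: uT; rewrite inE uA /= lt0n.
  have uv : u != v by apply: contraTneq wtru => ->; rewrite v0.
  have E : wt G r u = wt G u v.
    by rewrite -wset1 (wset_eq_wt cG cr (exA uA vA)) ?nr // wset1.
  have jr : j \notin [set r] by rewrite inE; apply: contraTneq jB => ->.
  have vA0 : v \in A0 by rewrite inE vA orbT.
  have uj : j != u by rewrite eq_sym neq_AB.
  have vj : j != v by rewrite eq_sym neq_AB.
  (* Here [u] is adjacent to the root and [v] only to [u]: burning [u], [j], [v] after the root,
     with [wt G r u = wt G u v], refutes every alternative. *)
  have [|||_] := swap3 cG cr (exA uA vA) (nr _ uA) jr (nr _ vA) uv uj vj;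
    rewrite !wset1 // ?addn_gt0 ?(pos u) ?wtuv ?orbT //.
  rewrite v0 (wtC _ j v) E; case; move: (pos v vA) (pos u uA) wtuv; clear; lia.
have [|H|H] := attached_dichotomy cr sr; first by rewrite wset1.
  have [x xA] := A_attached; by rewrite H // inE xA nr.
by move=> y yA; have := H y; rewrite wset1 => H'; apply: H'; rewrite inE yA nr.
Qed.

(** * Equality of the weights at A *)

Lemma wt_root_eq : {in A &, forall x y, wt G r x = wt G r y}.
Proof.
move=> x y xA yA; have [->//|neq] := eqVneq x y.
have nr z : z \in A -> z \notin [set r] by rewrite inE; apply: contraTneq => ->.
rewrite -!wset1; apply: (wset_eq cG (conn_root G) (exA xA yA)); rewrite ?nr ?wset1 //.
  by case: (root_adj xA).
by case: (root_adj yA).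
Qed.

(** The root need not be joined to [j], so [wt_eq_attached] cannot be used with [S = {r}]. Instead
    [j] is burnt between [x] and [y], and the equal root weights cancel in the first conclusion of
    [swap3]. *)
Lemma wtAB_eq : {in A &, forall x y, wt G x j = wt G y j}.
Proof.
suff le : {in A &, forall x y, x != y -> wt G y j <= wt G x j}.
  move=> x y xA yA; have [->//|neq] := eqVneq x y.
  by apply/eqP; rewrite eqn_leq !le // eq_sym.
move=> x y xA yA neq.
have nr z : z \in A -> z \notin [set r] by rewrite inE; apply: contraTneq => ->.
have jr : j \notin [set r] by rewrite inE; apply: contraTneq jB => ->.
have [xA0 yA0] : x \in A0 /\ y \in A0 by rewrite !inE xA yA !orbT.
have xj : j != x by rewrite eq_sym neq_AB.
have yj : j != y by rewrite eq_sym neq_AB.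
have [[rx wx] [ry wy]] := (root_adj xA, root_adj yA).
have [|||] := swap3 cG (conn_root G) (exA xA yA) (nr _ xA) jr (nr _ yA) neq xj yj;
  rewrite ?wset1 ?addn_gt0 ?rx ?ry ?wx ?orbT //.
by rewrite (wt_root_eq xA yA) !(wtC _ j) leq_add2l.
Qed.

Lemma wtA_eq x y x' y' : x \in A -> y \in A -> x' \in A -> y' \in A ->
  x != y -> x' != y' -> wt G x y = wt G x' y'.
Proof.
have nr z : z \in A -> z \notin [set r] by rewrite inE; apply: contraTneq => ->.
(* Two edges of [G[A]] at a common vertex [z] are compared by exchanging their other ends over the
   root and [z]; arbitrary edges follow through an edge that meets both. *)
have eqr : {in A & &, forall z u v, z != u -> z != v -> wt G z u = wt G z v}.
  move=> z u v zA uA vA zu zv; have [->//|neq] := eqVneq u v.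
  have [[rz _] [ru _] [rv _]] := And3 (root_adj zA) (root_adj uA) (root_adj vA).
  have cz : conn G (z |: [set r]) by apply: connU1; [exact: conn_root|rewrite wset1].
  have := wset_eq cG cz (exA uA vA) _ _ neq.
  rewrite !in_setU1 !negb_or !nr // !(eq_sym _ z) zu zv !wsetU1 ?nr // !wset1 !addn_gt0 ru rv !orbT.
  by move=> /(_ isT isT isT isT); rewrite (wt_root_eq uA vA); apply: addIn.
move=> xA yA x'A y'A xy x'y'; have [Ex|xx'] := eqVneq x x'; first by rewrite -Ex in x'y' *; apply: eqr.
by rewrite (eqr x y x') // wtC (eqr x' x y') // eq_sym.
Qed.

End TwoClasses.

(** * Passing between weights and isomorphisms *)

Lemma connected_stable (V : finType) (G : mgraph V) : ~ ~ connected G -> connected G.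
Proof.
move=> H u v; case: (boolP (connect (adj G) u v)) => // n.
by case: H => cG; rewrite cG in n.
Qed.

(** The root heads the list [s], so the index in [s] sends it to [ord0]. The value [y = 0] is
    allowed, which covers stars. *)
Lemma riso_rcomplete (V : finType) (G : rooted_graph V) (S : {set V}) x y :
  groot G \notin S -> {in S, forall v, wt G (groot G) v = x} ->
  {in S &, forall u v, u != v -> wt G u v = y} ->
  riso (rinduced G S) (rcomplete #|S| x y).
Proof.
move=> rS wx wy; pose s := groot G :: enum S.
have mem_s (u : {v | v \in groot G |: S}) : val u \in s.
  by case: u => v /=; rewrite !inE mem_enum.
have lt_s (u : {v | v \in groot G |: S}) : index (val u) s < #|S|.+1.
  by have := mem_s u; rewrite -index_mem /= -cardE.
pose f u := Ordinal (lt_s u).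
have f_inj : injective f.
  move=> u v fuv; apply: val_inj; have E : index (val u) s = index (val v) s := congr1 val fuv.
  by rewrite -(nth_index (groot G) (mem_s u)) -(nth_index (groot G) (mem_s v)) E.
have f0 u : (f u == ord0) = (val u == groot G).
  by rewrite -val_eqE /= (eq_sym (sval u)); case: (_ == sval u).
exists f; split.
- apply: inj_card_bij => //; rewrite card_ord card_sig.
  by have := cardsU1 (groot G) S; rewrite rS add1n => <-; apply/eq_leq/eq_card.
- by apply/eqP; rewrite f0.
move=> u v; rewrite /= /rcomplete_wt (inj_eq f_inj) !f0 -val_eqE /= /induced_wt.
case: u v => u /= uS [v /= vS]; have [->|neq] := eqVneq u v; first by rewrite wtxx.
case/setU1P: uS neq => [->|uS] neq; case/setU1P: vS neq => [->|vS] neq;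
  rewrite ?eqxx ?orbT //=.
- by rewrite eqxx in neq.
- by rewrite wx.
- by rewrite wtC wx.
have nr z : z \in S -> (z == groot G) = false by apply: contraTF => /eqP->.
by rewrite wy // !nr.
Qed.

Lemma iso_complete (V : finType) (G : mgraph V) (S : {set V}) y :
  {in S &, forall u v, u != v -> wt G u v = y} -> iso (induced G S) (complete #|S| y).
Proof.
move=> wy; have E : #|{: {v | v \in S}}| = #|S| by rewrite card_sig.
exists (fun u => cast_ord E (enum_rank u)); split.
  apply: inj_card_bij; last by rewrite card_ord E.
  by move=> u v /cast_ord_inj/enum_rank_inj.
move=> u v; rewrite /= /complete_wt (inj_eq (@cast_ord_inj _ _ _)) (inj_eq enum_rank_inj).
rewrite /induced_wt; have [->|neq] := eqVneq u v; first by rewrite wtxx.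
by rewrite wy //; apply: valP.
Qed.

Lemma riso_contract (V : finType) (G : rooted_graph V) (S : {set V}) n e d :
  riso (contract G S) (rcomplete n e d) ->
  [/\ #|~: S| = n, {in ~: S, forall v, wset G S v = e}
    & {in ~: S &, forall u v, u != v -> wt G u v = d}].
Proof.
case=> f [f_bij /= fN fwt]; have f_inj := bij_inj f_bij.
have f0 x : (f (Some x) == ord0) = false by rewrite -fN (inj_eq f_inj).
split=> [|v|u v]; rewrite ?inE.
- have := bij_eq_card f_bij; rewrite card_ord card_option card_sig => -[<-].
  by apply: eq_card => x; rewrite !inE.
- move=> vS; have := fwt None (Some (exist _ v vS)).
  by rewrite fN /= /rcomplete_wt eq_sym f0 eqxx /= => ->.
move=> uS vS neq; have := fwt (Some (exist _ u uS)) (Some (exist _ v vS)).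
rewrite /= /rcomplete_wt !f0 (inj_eq f_inj) /= => <-.
by rewrite -[_ == _]/(u == v) (negPf neq).
Qed.

Lemma card_setA p q : #|setA p q| = p.
Proof.
rewrite -[RHS]card_ord -(card_imset predT (inj_comp (@lift_inj _ ord0) (@lshift_inj p q))).
apply: eq_card => x; apply/idP/imsetP => [|[i _ ->]]; last by rewrite inE /=.
rewrite inE => /andP[x0 xp]; have lt_x : x.-1 < p by lia.
by exists (Ordinal lt_x) => //; apply: val_inj; rewrite /= /bump; lia.
Qed.

Lemma card_setB p q : #|setB p q| = q.
Proof.
rewrite -[RHS]card_ord -(card_imset predT (@rshift_inj p.+1 q)).
apply: eq_card => x; apply/idP/imsetP => [|[i _ ->]]; last by rewrite inE /= leq_addr.
rewrite inE => px; have lt_x : x - p.+1 < q by have := ltn_ord x; lia.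
by exists (Ordinal lt_x) => //; apply: val_inj; rewrite /= subnKC.
Qed.

Lemma type_I_exch p q (G : rooted_graph 'I_(p + q).+1) : type_I G ->
  {in setA p q &, forall x y, exch G x y} /\ {in setB p q &, forall x y, exch G x y}.
Proof.
case=> _ _ _ _ inv.
have on (S : {set 'I_(p + q).+1}) x y : x \in S -> y \in S -> perm_on S (tperm x y).
  by move=> xS yS; apply: subset_trans (tperm_on x y) _; rewrite subUset !sub1set xS.
split=> x y xS yS b pb.
  by have := inv (tperm x y) 1%g b (on _ _ _ xS yS) (perm_on1 _) pb; rewrite mulg1.
by have := inv 1%g (tperm x y) b (perm_on1 _) (on _ _ _ xS yS) pb; rewrite mul1g.
Qed.

(** * The equal weights assembled into the shape of G *)

Theorem theorem6p14 (p q d e : nat) (G : rooted_graph 'I_(p + q).+1)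
  (hd : 0 < d) (he : 0 < e)
  (hG : type_I G)
  (hcut : forall v, ~ cut_vertex G v)
  (hquot :
     (riso (contract G (groot G |: setA p q)) (rcomplete 2 e d) /\
      exists2 v, v \in setB p q
        & 1 < #|[set u in groot G |: setA p q | adj G v u]|)
     \/
     (3 <= q /\ riso (contract G (groot G |: setA p q)) (rcomplete q e d))) :
  [/\ (exists2 a, 0 < a & riso (rinduced G (setA p q)) (star p a)) \/
      (exists a b, [/\ 0 < a, 0 < b
         & riso (rinduced G (setA p q)) (rcomplete p a b)]),
      (exists2 w, 0 < w
         & forall u v, u \in setA p q -> v \in setB p q -> wt G u v = w)
    & (exists2 c, 0 < c & riso (rinduced G (setB p q)) (rcomplete q c d)) \/
      (iso (induced G (setB p q)) (complete q d) /\
       forall v, v \in setB p q -> ~~ adj G (groot G) v)].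
Proof.
have [exA exB] := type_I_exch hG.
have [[p_gt0 q_gt0] r0 cG cGA _] := hG.
set A := setA p q in exA exB hquot cGA *; set B := setB p q in exA exB hquot *.
have rA : groot G \notin A by rewrite r0 inE.
have rB : groot G \notin B by rewrite r0 inE.
have EB : ~: (groot G |: A) = B.
  by apply/setP=> x; rewrite !inE r0 -val_eqE /=; lia.
have AB : [disjoint A & B].
  by rewrite -setI_eq0; apply/eqP/setP=> x; rewrite !inE; lia.
have cover v : v \in groot G |: A \/ v \in B.
  by rewrite -EB in_setC; case: (v \in _); [left|right].
have cA : conn G (groot G |: A) by apply: connected_conn => //; apply: setU11.
have nocut v : connected (induced G [set~ v]) by apply: connected_stable (hcut v).
have A_neq0 : A != set0 by rewrite -card_gt0 card_setA.
(* Both cases are treated with a common size [n] of the quotient; in the triangle case [n = 2], and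
   the quotient determines the size of [B]. *)
have [n [q_gt1 hcon hn]] : exists n, [/\ 1 < n, riso (contract G (groot G |: A)) (rcomplete n e d)
    & n = 2 /\ (exists2 v, v \in B & 1 < #|[set u in groot G |: A | adj G v u]|) \/ 2 < n].
  case: hquot => [[hc hv]|[q3 hc]]; first by exists 2; split=> //; left.
  by exists q; split=> //; [apply: ltnW|right].
have [cardB wA0B wtB] := riso_contract hcon.
rewrite EB in cardB wA0B wtB.
have unif : uniform G A B.
  case: hn => [[n2 [v vB v2]]|n3].
    by apply: (uniform_eq2 cG rB AB exA exB cA hd he wtB wA0B _ vB v2); rewrite cardB.
  by apply: (uniform_gt2 cG rB AB exB hd wtB); rewrite cardB.
have /card_gt0P[j jB] : 0 < #|B| by rewrite card_setB.
have /card_gt0P[k] : 0 < #|B :\ j|.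
  by move: q_gt1; rewrite -cardB (cardsD1 j) jB; lia.
rewrite in_setD1 => /andP[kj kB]; rewrite eq_sym in kj.
have /set0Pn[x0 x0A] := A_neq0.
have rootA := root_adj cG rB AB exA cA hd wtB rA cover nocut A_neq0 unif jB kB kj.
have wr := wt_root_eq cG rB AB exA cA hd wtB rA cover nocut A_neq0 unif jB kB kj.
have wAB := wtAB_eq cG rB AB exA cA hd wtB rA cover nocut A_neq0 unif jB kB kj.
have wA := wtA_eq cG rB AB exA cA hd wtB rA cover nocut A_neq0 unif jB kB kj.
have wB := wtAB cA unif.
split.
(* The maximum is the common weight inside [A], and is 0 when [A] has a single vertex; [b = 0] is
   the star case. *)
- pose b := \max_(x in A) \max_(y in A) wt G x y.
  have wb : {in A &, forall x y, x != y -> wt G x y = b}.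
    move=> x y xA yA xy; apply/eqP; rewrite eqn_leq; apply/andP; split.
      by rewrite /b (bigD1 x) //= (bigD1 y) //= leq_max leq_max leqnn.
    apply/bigmax_leqP => x' x'A; apply/bigmax_leqP => y' y'A.
    have [->|xy'] := eqVneq x' y'; first by rewrite wtxx.
    by rewrite (wA x' y' x y).
  have wx x : x \in A -> wt G (groot G) x = wt G (groot G) x0 by move=> xA; apply: wr.
  have := riso_rcomplete rA wx wb; rewrite card_setA => Hiso.
  have [a_gt0 _] := rootA x0 x0A.
  have [Eb|b_gt0] := posnP b; first by left; exists (wt G (groot G) x0) => //; rewrite /star -Eb.
  by right; exists (wt G (groot G) x0), b.
- exists (wt G x0 j) => [|u v uA vB]; first by case: (rootA x0 x0A).
  by rewrite (wB u _ v j) ?(wAB u x0) // inE uA orbT.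
have wc v : v \in B -> wt G (groot G) v = wt G (groot G) j.
  by move=> vB; apply: wB; rewrite ?setU11.
case: (posnP (wt G (groot G) j)) => [c0|c_gt0]; [right|left].
  split; first by have := iso_complete wtB; rewrite card_setB.
  by move=> v vB; rewrite /adj wc // c0.
by exists (wt G (groot G) j) => //; have := riso_rcomplete rB wc wtB; rewrite card_setB.
Qed.
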